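(* Let $L,n\ge1$ be integers with $Ln>2$, let $\boldsymbol{\Sigma}$ be a full-rank $n\times n$ covariance matrix, let the data be multivariate white noise $\mathbf{x}_t=\boldsymbol{\epsilon}_t$ with covariance $\boldsymbol{\Sigma}$, and let $\boldsymbol{\gamma}_\delta\neq\mathbf{0}$. Fix $i\in\{1,\dots,n\}$ and assume that $\boldsymbol{\gamma}_{i\cdot\delta}$ has complete spectral support. Consider the dual optimization problem $$\max_{\mathbf{b}_i}\rho(y_{i})\quad\text{subject to}\quad \rho(y_i,z_i,\delta)=\rho_{iyz},\quad \mathbf{b}_i'\tilde{\mathbf{I}}\mathbf{b}_i=l,$$ and assume $\rho_{iyz}>\rho(y_{i,MSE}^{\rho_{max}},z_i,\delta)$ and $|\rho_{iyz}|<\rho(y_{i,MSE},z_i,\delta)$ (notation as in the context). Then: (a) The solution of the dual problem has the same parametric form as the M-SSA solution: $$\mathbf{b}_{i}=\tilde{D}_i\tilde{\mathbf{N}}_i^{-1}\tilde{\mathbf{I}}\boldsymbol{\gamma}_{i\cdot\delta},\qquad \tilde{\mathbf{N}}_i:=2\tilde{\mathbf{M}}-\tilde{\nu}_i\tilde{\mathbf{I}},\qquad( ** )$$ where $\tilde{\mathbf{N}}_i$ has full rank and $\tilde{D}_i\neq0$, $\tilde{\nu}_i$ can be chosen to satisfy the constraints. (b) Let $y_{it}(\nu_{0i})$ be the solution of the original M-SSA problem for the $i$-th target, of the form $\mathbf{b}_i=D_i(2\tilde{\mathbf{M}}-\nu_{0i}\tilde{\mathbf{I}})^{-1}\tilde{\mathbf{I}}\boldsymbol{\gamma}_{i\cdot\delta}$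 with $\nu_{0i}>2\rho_{max}(L)$, and set $\rho_{iyz}:=\rho(y_i(\nu_{0i}),z_i,\delta)$ in the dual problem. If the search for an optimal $\tilde{\nu}_i$ in $( ** )$ can be confined to $\{\nu : |\nu|>2\rho_{max}(L)\}$, then $y_{it}(\nu_{0i})$ is also an optimal solution of the dual problem. (c) If instead $\nu_{0i}<-2\rho_{max}(L)$ (with the same choice $\rho_{iyz}:=\rho(y_i(\nu_{0i}),z_i,\delta)$ and the same confinement of the search for $\tilde\nu_i$), then $y_{it}(\nu_{0i})$ remains optimal for the dual problem provided that the maximization of $\rho(y_i)$ is replaced by minimization.
   Context: Matrices and spectral notation. $\mathbf{M}$ is the $L\times L$ symmetric tridiagonal matrix with zero diagonal and $1/2$ on the first super- and sub-diagonals. Its eigenvalues are $\lambda_k=\cos(k\pi/(L+1))$, $k=1,\dots,L$ (distinct, in decreasing order), with orthonormal eigenvectors $\mathbf{v}_k\propto(\sin(mk\pi/(L+1)))_{m=1,\dots,L}$. Put $\rho_{max}(L):=\lambda_1=\cos(\pi/(L+1))$. $\boldsymbol{\Sigma}$ (symmetric positive definite, $n\times n$) has eigenvalues $\tilde{\sigma}_j>0$ and orthonormal eigenvectors $\mathbf{v}_{\sigma j}$, $j=1,\dots,n$. Set $\tilde{\mathbf{I}}:=\boldsymbol{\Sigma}\otimes\mathbf{I}_{L\times L}$, $\tilde{\mathbf{M}}:=\boldsymbol{\Sigma}\otimes\mathbf{M}$ and $\tilde{\mathbf{v}}_{kj}:=\mathbf{v}_{\sigma j}\otimes\mathbf{v}_k$,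 an orthonormal basis of $\mathbb{R}^{nL}$. Target, predictor. $\boldsymbol{\epsilon}_t=(\epsilon_{1t},\dots,\epsilon_{nt})'$ is zero-mean white noise with covariance $\boldsymbol{\Sigma}$; the target is $\mathbf{z}_{t+\delta}=\sum_{|k|<\infty}\boldsymbol{\Gamma}_k\boldsymbol{\epsilon}_{t+\delta-k}$, $\delta\in\mathbb{Z}$, with square-summable $n\times n$ matrices $\boldsymbol{\Gamma}_k=(\gamma_{ijk})_{i,j}$. Put $\boldsymbol{\gamma}_{ij\delta}=(\gamma_{ij\delta},\dots,\gamma_{ij,\delta+L-1})'\in\mathbb{R}^L$, $\boldsymbol{\gamma}_{i\cdot\delta}=(\boldsymbol{\gamma}_{i1\delta}',\dots,\boldsymbol{\gamma}_{in\delta}')'\in\mathbb{R}^{nL}$, $\boldsymbol{\gamma}_\delta=(\boldsymbol{\gamma}_{1\cdot\delta},\dots,\boldsymbol{\gamma}_{n\cdot\delta})$. A predictor with weights $\mathbf{b}_i=(\mathbf{b}_{i1}',\dots,\mathbf{b}_{in}')'\in\mathbb{R}^{nL}$, $\mathbf{b}_{ij}\in\mathbb{R}^L$, is $y_{it}=\sum_{j=1}^n\mathbf{b}_{ij}'(\epsilon_{jt},\dots,\epsilon_{j,t-L+1})'$. Its first-order autocorrelation is $\rho(y_i)=\mathbf{b}_i'\tilde{\mathbf{M}}\mathbf{b}_i/\mathbf{b}_i'\tilde{\mathbf{I}}\mathbf{b}_i$ and its target correlation is $\rho(y_i,z_i,\delta):=\mathbf{b}_i'\tilde{\mathbf{I}}\boldsymbol{\gamma}_{i\cdot\delta}/\sqrt{\mathbf{b}_i'\tilde{\mathbf{I}}\mathbf{b}_i\;\boldsymbol{\gamma}_{i\cdot\delta}'\tilde{\mathbf{I}}\boldsymbol{\gamma}_{i\cdot\delta}}$.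 Spectral weights: $\boldsymbol{\gamma}_{i\cdot\delta}=\sum_{k=1}^L\sum_{j=1}^n w_{ikj}\tilde{\mathbf{v}}_{kj}$. Complete spectral support means $\sum_{j=1}^n|w_{ikj}|\ne0$ for every $k=1,\dots,L$. $y_{i,MSE}$ is the predictor with weights $\boldsymbol{\gamma}_{i\cdot\delta}$ (the mean-squared-error predictor); $y_{i,MSE}^{\rho_{max}}$ is the predictor with weights $\sum_{j=1}^n w_{i1j}\tilde{\mathbf{v}}_{1j}$ (orthogonal projection of $\boldsymbol{\gamma}_{i\cdot\delta}$ onto the span of $\tilde{\mathbf{v}}_{11},\dots,\tilde{\mathbf{v}}_{1n}$). Original M-SSA problem for the $i$-th target with parameter $\rho_i$: maximize $\boldsymbol{\gamma}_{i\cdot\delta}'\tilde{\mathbf{I}}\mathbf{b}_i$ over $\mathbf{b}_i\in\mathbb{R}^{nL}$ subject to $\mathbf{b}_i'\tilde{\mathbf{M}}\mathbf{b}_i=l\rho_i$ and $\mathbf{b}_i'\tilde{\mathbf{I}}\mathbf{b}_i=l$, where $l>0$ is a fixed scaling constant. ''The search for an optimal $\tilde\nu_i$ can be confined to a set $S$'' means that an optimizer of the dual problem can be found among the feasible vectors of the form $( ** )$ with $\tilde\nu_i\in S$. *)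

(* Defs.v *)
From HB Require Import structures.
From mathcomp Require Import all_boot all_order all_algebra.
From mathcomp Require Import all_classical all_reals all_analysis.
From mathcomp Require Export mxtens.
Import Order.TTheory GRing.Theory Num.Theory.
Import numFieldNormedType.Exports.

Set Implicit Arguments.
Unset Strict Implicit.
Unset Printing Implicit Defensive.

Local Open Scope ring_scope.

Section Optimization.
Context (U : Type) (R : realType).

Definition is_maximizer (feasible : U -> Prop) (f : U -> R) (b : U) : Prop :=
  feasible b /\ forall b', feasible b' -> f b' <= f b.

Definition is_minimizer (feasible : U -> Prop) (f : U -> R) (b : U) : Prop :=
  feasible b /\ forall b', feasible b' -> f b <= f b'.

End Optimization.

Section Matrices.
Context (R : realType).

Definition bilform N (A : 'M[R]_N) (x y : 'cV[R]_N) : R := (x^T *m A *m y) 0 0.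

Definition sym_posdef n (A : 'M[R]_n) : Prop :=
  A^T = A /\ forall x : 'cV[R]_n, x != 0 -> 0 < bilform A x x.

Definition orthonormal_eigenbasis n (A : 'M[R]_n)
    (s : 'I_n -> R) (v : 'I_n -> 'cV[R]_n) : Prop :=
  (forall j, A *m v j = s j *: v j) /\
  (forall i j, ((v i)^T *m v j) 0 0 = (i == j)%:R).

Definition Mmx (L : nat) : 'M[R]_L :=
  \matrix_(r < L, c < L)
    if (r.+1 == c :> nat) || (c.+1 == r :> nat) then 2^-1 else 0.

Definition rho_max (L : nat) : R := cos (pi / L.+1%:R).

(* Zero-based: k : 'I_L is the k.+1-st eigenvector of Mmx L, belonging to the
   k.+1-st largest eigenvalue cos (k.+1 * pi / L.+1). *)
Definition sinvec (L : nat) (k : 'I_L) : 'cV[R]_L :=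
  \col_(m < L) sin ((m.+1 * k.+1)%:R * pi / L.+1%:R).

Definition Mvec (L : nat) (k : 'I_L) : 'cV[R]_L :=
  (Num.sqrt (\sum_(m < L) sinvec k m 0 ^+ 2))^-1 *: sinvec k.

(* A vector of R^(n L) is a stack of n blocks of length L; coordinate m of
   block j sits at mxtens_index (j, m). *)
Definition tildeI n (L : nat) (Sigma : 'M[R]_n) : 'M[R]_(n * L) :=
  Sigma *t (1%:M : 'M[R]_L).

Definition tildeM n (L : nat) (Sigma : 'M[R]_n) : 'M[R]_(n * L) :=
  Sigma *t Mmx L.

Definition tildeV n (L : nat) (vs : 'I_n -> 'cV[R]_n) (k : 'I_L) (j : 'I_n) :
    'cV[R]_(n * L) :=
  vs j *t Mvec k.

Definition tildeN n (L : nat) (Sigma : 'M[R]_n) (nu : R) : 'M[R]_(n * L) :=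
  2 *: tildeM L Sigma - nu *: tildeI L Sigma.

End Matrices.

Section Target.
Context (R : realType) (n : nat).

(* Gam k is the coefficient matrix at lag k of the bi-infinite filter that
   defines the target. *)
Definition square_summable (Gam : int -> 'M[R]_n) : Prop :=
  forall i j, summable [set: int] (fun k => (Gam k i j ^+ 2)%:E).

Definition gamma_row (L : nat) (Gam : int -> 'M[R]_n) (delta : int) (i : 'I_n) :
    'cV[R]_(n * L) :=
  \col_p let: (j, m) := mxtens_unindex p in Gam (delta + (m : nat)%:Z) i j.

Definition gamma_mx (L : nat) (Gam : int -> 'M[R]_n) (delta : int) :
    'M[R]_(n * L, n) :=
  \matrix_(p, i) gamma_row L Gam delta i p 0.

Definition target_corr (L : nat) (Sigma : 'M[R]_n) (g b : 'cV[R]_(n * L)) : R :=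
  bilform (tildeI L Sigma) b g /
  Num.sqrt (bilform (tildeI L Sigma) b b * bilform (tildeI L Sigma) g g).

(* For g = \sum_k \sum_j w k j *: tildeV vs k j. *)
Definition complete_spectral_support (L : nat) (w : 'I_L -> 'I_n -> R) : Prop :=
  forall k, \sum_(j < n) `|w k j| != 0.

End Target.

Section Processes.
Context (d : measure_display) (T : measurableType d) (R : realType).
Context (P : probability T R).

Definition white_noise n (Sigma : 'M[R]_n) (eps : int -> 'I_n -> T -> R) : Prop :=
  [/\ forall t j, eps t j \in Lfun P 2%:E,
      forall t j, 'E_P[eps t j]%E = 0%E,
      forall t j j', covariance P (eps t j) (eps t j') = (Sigma j j')%:E
    & forall s t j j', s != t -> covariance P (eps s j) (eps t j') = 0%E].

Definition predictor n (L : nat) (eps : int -> 'I_n -> T -> R)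
    (b : 'cV[R]_(n * L)) (t : int) : T -> R :=
  fun x => \sum_(j < n) \sum_(m < L)
    b (mxtens_index (j, m)) 0 * eps (t - (m : nat)%:Z) j x.

(* Both denominator variances of the correlation agree for a stationary
   process, which is the only case in which this is used. *)
Definition autocorr1 (y : int -> T -> R) (t : int) : R :=
  fine (covariance P (y t) (y (t - 1))) / fine 'V_P[y t]%E.

End Processes.

Section AutocorrelationFormula.
Context (d : measure_display) (T : measurableType d) (R : realType).
Context (P : probability T R).

Lemma Lfun2_lincomb (I : Type) (r : seq I) (u : I -> R) (X : I -> T -> R) :
  (forall a, X a \in Lfun P 2%:E) ->
  (fun x => \sum_(a <- r) u a * X a x) \in Lfun P 2%:E.
Proof.
move=> HX; elim: r => [|a r IH].
  rewrite (_ : (fun _ => _) = cst 0) ?Lfun_cst//.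
  by apply/funext => x; rewrite big_nil.
rewrite (_ : (fun _ => _) =
  ((u a \o* X a) + (fun x => \sum_(a <- r) u a * X a x))%R).
  have sX : u a \o* X a \in Lfun P 2%:E by rewrite Lfun_scale// ler1n.
  by rewrite rpredD ?lee1n.
by apply/funext => x; rewrite big_cons /= mulrC.
Qed.

Lemma covariance_lincombl (I : Type) (r : seq I) (u c : I -> R) (X : I -> T -> R) Y :
  (forall a, X a \in Lfun P 2%:E) -> Y \in Lfun P 2%:E ->
  (forall a, covariance P (X a) Y = (c a)%:E) ->
  covariance P (fun x => \sum_(a <- r) u a * X a x) Y
    = (\sum_(a <- r) u a * c a)%:E.
Proof.
move=> HX HY HC.
have PT : P setT \is a fin_num by rewrite fin_num_measure.
elim: r => [|a r IH].
  rewrite (_ : (fun _ => _) = cst 0) ?covariance_cst_l ?big_nil//.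
  by apply/funext => x; rewrite big_nil.
rewrite (_ : (fun _ => _) =
  ((u a \o* X a) \+ (fun x => \sum_(a <- r) u a * X a x))%R).
  rewrite covarianceDl ?Lfun2_lincomb//; last first.
    by apply: Lfun_scale => //; rewrite ler1n.
  rewrite covarianceZl ?Lfun2_mul_Lfun1 ?Lfun_subset12//.
  by rewrite HC IH big_cons EFinD EFinM.
by apply/funext => x; rewrite big_cons /= mulrC.
Qed.

Lemma covariance_lincomb (I : Type) (r : seq I) (u v : I -> R) (C : I -> I -> R)
    (X Y : I -> T -> R) :
  (forall a, X a \in Lfun P 2%:E) -> (forall a, Y a \in Lfun P 2%:E) ->
  (forall a c, covariance P (X a) (Y c) = (C a c)%:E) ->
  covariance P (fun x => \sum_(a <- r) u a * X a x)
               (fun x => \sum_(a <- r) v a * Y a x)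
    = (\sum_(a <- r) u a * \sum_(c <- r) v c * C a c)%:E.
Proof.
move=> HX HY HC; apply: covariance_lincombl => // [|a]; first exact: Lfun2_lincomb.
rewrite covarianceC; apply: covariance_lincombl => // c.
by rewrite covarianceC.
Qed.

Lemma bilform_tensE n L (A : 'M[R]_n) (B : 'M[R]_L) (b : 'cV[R]_(n * L)) :
  bilform (A *t B) b b =
  \sum_(p : 'I_n * 'I_L) b (mxtens_index p) 0 *
   \sum_(q : 'I_n * 'I_L) b (mxtens_index q) 0 * (A p.1 q.1 * B p.2 q.2).
Proof.
have bij : bijective (@mxtens_index n L).
  by exists (@mxtens_unindex n L); [exact: mxtens_indexK|exact: mxtens_unindexK].
rewrite /bilform -mulmxA mxE (reindex (@mxtens_index n L)) /=; last exact: onW_bij.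
apply: eq_bigr => -[j m] _; rewrite mxE; congr (_ * _).
rewrite mxE (reindex (@mxtens_index n L)) /=; last exact: onW_bij.
by apply: eq_bigr => -[j' m'] _; rewrite tensmxE mulrC.
Qed.

Lemma predictorE n L (eps : int -> 'I_n -> T -> R) (b : 'cV[R]_(n * L)) t :
  predictor eps b t = fun x => \sum_(p : 'I_n * 'I_L) b (mxtens_index p) 0 * eps (t - (p.2 : nat)%:Z) p.1 x.
Proof.
apply/funext => x; rewrite /predictor pair_bigA.
by apply: eq_bigr => -[].
Qed.

Lemma autocorr1_predictorE n L (Sigma : 'M[R]_n) (eps : int -> 'I_n -> T -> R)
   (b : 'cV[R]_(n * L)) (t : int) : Sigma^T = Sigma -> white_noise P Sigma eps ->
   autocorr1 P (predictor eps b) t =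
   bilform (tildeM L Sigma) b b / bilform (tildeI L Sigma) b b.
Proof.
move=> sS [e2 _ ecov ecov0]; rewrite /autocorr1 -[X in _ / fine X]/(covariance P _ _) !predictorE.
pose X (s : int) (p : 'I_n * 'I_L) := eps (s - (p.2 : nat)%:Z) p.1.
have HX s a : X s a \in Lfun P 2%:E by exact: e2.
pose u (p : 'I_n * 'I_L) := b (mxtens_index p) 0.
rewrite (@covariance_lincomb _ _ u u (fun p q : 'I_n * 'I_L => Sigma p.1 q.1 * (p.2 == q.2.+1 :> nat)%:R) (X t) (X (t - 1))) //; first last.
  move=> -[j m] [j' m'] /=; rewrite /X /=.
  have [->|ne] := eqVneq (m : nat) m'.+1.
    rewrite mulr1 (_ : t - 1 - m'%:Z = t - m'.+1%:Z) ?ecov//.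
    by rewrite -addrA -opprD -intS.
  rewrite mulr0 ecov0//; apply: contra ne => /eqP.
  by rewrite -addrA -opprD -intS => /addrI /oppr_inj [->].
rewrite (@covariance_lincomb _ _ u u (fun p q : 'I_n * 'I_L => Sigma p.1 q.1 * (p.2 == q.2)%:R) (X t) (X t)) //; first last.
  move=> -[j m] [j' m'] /=; rewrite /X /=.
  have [->|ne] := eqVneq m m'; first by rewrite mulr1 ecov.
  rewrite mulr0 ecov0//; apply: contra ne => /eqP.
  by move=> /addrI /oppr_inj [/val_inj ->].
rewrite !bilform_tensE /=; congr (_ / _); last first.
  by apply: eq_bigr => p _; congr (_ * _); apply: eq_bigr => q _; rewrite !mxE.
have half (x y : R) : x + x = 2 * y -> x = y.
  by rewrite -mulr2n -[x *+ 2]mulr_natl => /mulfI; apply; rewrite pnatr_eq0.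
apply: half.
under eq_bigr do rewrite mulr_sumr.
rewrite [X in _ + X]exchange_big -big_split mulr_sumr; apply: eq_bigr => p _ /=.
rewrite -big_split /= mulrCA !mulr_sumr; apply: eq_bigr => q _.
have sSE : Sigma q.1 p.1 = Sigma p.1 q.1 by rewrite -{1}sS mxE.
rewrite !mxE sSE -/(u p) -/(u q).
have E (x y s c e : R) : x * (y * (s * c)) + y * (x * (s * e)) = x * (y * (s * (c + e))).
  by rewrite !mulrDr; congr (_ + _); rewrite mulrCA.
rewrite E [2 * _]mulrCA [2 * _]mulrCA; do 3 congr (_ * _).
case: (eqVneq (p.2 : nat) q.2.+1) => [->|_].
  by rewrite orbT divff ?pnatr_eq0 // ltn_eqF ?addr0// ltnS leqnSn.
rewrite orbF eq_sym add0r; case: eqP; rewrite ?mulr0 ?divff ?pnatr_eq0//.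
Qed.
End AutocorrelationFormula.

Section Problems.
Context (R : realType) (n L : nat) (Sigma : 'M[R]_n) (g : 'cV[R]_(n * L)).

Definition mssa_feasible (l rho : R) (b : 'cV[R]_(n * L)) : Prop :=
  bilform (tildeM L Sigma) b b = l * rho /\ bilform (tildeI L Sigma) b b = l.

Definition mssa_solution (l rho : R) (b : 'cV[R]_(n * L)) : Prop :=
  is_maximizer (mssa_feasible l rho) (fun b => bilform (tildeI L Sigma) g b) b.

Definition dual_feasible (l rho_yz : R) (b : 'cV[R]_(n * L)) : Prop :=
  target_corr Sigma g b = rho_yz /\ bilform (tildeI L Sigma) b b = l.

Definition mssa_vec (D nu : R) : 'cV[R]_(n * L) :=
  D *: (invmx (tildeN L Sigma nu) *m tildeI L Sigma *m g).

(* invmx is meaningful only under the rank condition, which is therefore part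
   of the form. *)
Definition mssa_form (nu : R) (b : 'cV[R]_(n * L)) : Prop :=
  tildeN L Sigma nu \in unitmx /\ exists2 D : R, D != 0 & b = mssa_vec D nu.

Definition search_confined_to (S : R -> Prop) (optimal : 'cV[R]_(n * L) -> Prop) :
    Prop :=
  exists b, optimal b /\ exists2 nu : R, S nu & mssa_form nu b.

End Problems.

Section Dual.
Context (d : measure_display) (T : measurableType d) (R : realType).
Context (P : probability T R) (n L : nat) (Sigma : 'M[R]_n).
Context (eps : int -> 'I_n -> T -> R) (g : 'cV[R]_(n * L)).

Definition dual_solution (t : int) (l rho_yz : R) : 'cV[R]_(n * L) -> Prop :=
  is_maximizer (dual_feasible Sigma g l rho_yz)
    (fun b => autocorr1 P (predictor eps b) t).

Definition dual_min_solution (t : int) (l rho_yz : R) : 'cV[R]_(n * L) -> Prop :=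
  is_minimizer (dual_feasible Sigma g l rho_yz)
    (fun b => autocorr1 P (predictor eps b) t).

End Dual.

(* Main.v *)
Require Import Defs.
From mathcomp Require Import all_boot all_order all_algebra.
From mathcomp Require Import all_classical all_reals all_analysis.
From mathcomp Require Import ring lra.
Import Order.TTheory GRing.Theory Num.Theory.
Import numFieldNormedType.Exports.

(* In the basis tildeV the forms tildeI, tildeM and tildeN are diagonal, with
   entries sigma_j, sigma_j lambda_k and sigma_j (2 lambda_k - nu); hence tildeN
   is definite as soon as |nu| > 2 rho_max.  If b = D tildeN^-1 tildeI g, any
   other feasible b' gives
     (b' - b)^T tildeN (b' - b) = 2 l (rho(y') - rho(y)),
   because the two constraints fix the cross term.  So a feasible b of this form
   is the unique maximizer when nu > 2 rho_max and a minimizer when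
   nu < - 2 rho_max.  A feasible nu > 2 rho_max exists by the intermediate value
   theorem: the target correlation of b runs from that of the MSE predictor
   (nu infinite) down to that of its projection on the top eigenspace
   (nu = 2 rho_max). *)

Set Implicit Arguments.
Unset Strict Implicit.
Unset Printing Implicit Defensive.

Local Open Scope ring_scope.

(** * Bilinear forms diagonalized by a complete family of vectors *)

Section Bilform.
Context (R : realType) (N : nat).
Implicit Types (A B : 'M[R]_N) (x y z : 'cV[R]_N) (a : R).

Lemma bilform_sym A x y : A^T = A -> bilform A x y = bilform A y x.
Proof.
by move=> sA; rewrite /bilform -[x^T *m A *m y]trmxK mxE !trmx_mul trmxK sA mulmxA.
Qed.

Lemma bilformBl A x y z : bilform A (x - y) z = bilform A x z - bilform A y z.
Proof. by rewrite /bilform raddfB /= !mulmxBl !mxE. Qed.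

Lemma bilformBr A x y z : bilform A z (x - y) = bilform A z x - bilform A z y.
Proof. by rewrite /bilform mulmxBr !mxE. Qed.

Lemma bilformZl A a x z : bilform A (a *: x) z = a * bilform A x z.
Proof. by rewrite /bilform linearZ /= -!scalemxAl mxE. Qed.

Lemma bilformZr A a x z : bilform A z (a *: x) = a * bilform A z x.
Proof. by rewrite /bilform -!scalemxAr mxE. Qed.

Lemma bilform_mulmx A B x y z : A *m y = B *m z -> bilform A x y = bilform B x z.
Proof. by rewrite /bilform -!mulmxA => ->. Qed.

Definition coordinate x y : R := (x^T *m y) 0 0.

Lemma coordinateC x y : coordinate x y = coordinate y x.
Proof. by rewrite /coordinate -[in RHS](trmxK x) -trmx_mul [RHS]mxE. Qed.

(** Inserting the resolution of the identity in front of [y] splits the form into rank-one pieces,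
    and [A] acts on each as a scalar. *)
Lemma bilform_diag (I : finType) (e : I -> 'cV[R]_N) A (c : I -> R) x y :
  \sum_p e p *m (e p)^T = 1%:M -> (forall p, A *m e p = c p *: e p) ->
  bilform A x y = \sum_p c p * coordinate (e p) x * coordinate (e p) y.
Proof.
move=> e1 eA; rewrite /bilform -[y in LHS]mul1mx -e1 mulmx_suml mulmx_sumr summxE.
apply: eq_bigr => p _; rewrite -(mulmxA (e p)) mulmxA -(mulmxA _ A) eA.
rewrite -scalemxAr -scalemxAl !mxE big_ord1 -mulrA; congr (_ * _).
by rewrite -/(coordinate _ _) coordinateC.
Qed.

Lemma bilformNmx A x y : bilform (- A) x y = - bilform A x y.
Proof. by rewrite /bilform mulmxN mulNmx mxE. Qed.

(** If the sum of nonnegative terms vanished, every coordinate of [x] would vanish, and the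
    resolution of the identity would give [x = 0]. *)
Lemma bilform_diag_gt0 (I : finType) (e : I -> 'cV[R]_N) A (c : I -> R) x :
  \sum_p e p *m (e p)^T = 1%:M -> (forall p, A *m e p = c p *: e p) ->
  (forall p, 0 < c p) -> x != 0 -> 0 < bilform A x x.
Proof.
move=> e1 eA c0 x0; rewrite (bilform_diag _ _ e1 eA).
have ge0 p : 0 <= c p * coordinate (e p) x * coordinate (e p) x.
  by rewrite -mulrA mulr_ge0 ?(ltW (c0 p))// -expr2 sqr_ge0.
rewrite lt_def sumr_ge0 ?andbT//; apply: contra x0 => /eqP /psumr_eq0P z.
rewrite -[x]mul1mx -e1 mulmx_suml big1// => p _.
rewrite -mulmxA (_ : (e p)^T *m x = 0) ?mulmx0//.
apply/matrixP => i j; rewrite !ord1 [RHS]mxE -/(coordinate _ _).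
have /eqP : c p * coordinate (e p) x * coordinate (e p) x = 0 by apply: z => // *; exact: ge0.
by rewrite !mulf_eq0 gt_eqF//= orbb => /eqP.
Qed.

(** Inverting the eigenvalues in the spectral decomposition gives an explicit right inverse. *)
Lemma unitmx_diag (I : finType) (e : I -> 'cV[R]_N) A (c : I -> R) :
  \sum_p e p *m (e p)^T = 1%:M -> (forall p, A *m e p = c p *: e p) ->
  (forall p, c p != 0) -> A \in unitmx.
Proof.
move=> e1 eA c0.
suff /mulmx1_unit[] : A *m (\sum_p (c p)^-1 *: (e p *m (e p)^T)) = 1%:M by [].
rewrite mulmx_sumr -[RHS]e1; apply: eq_bigr => p _.
by rewrite -scalemxAr mulmxA eA -scalemxAl scalerA mulVf// scale1r.
Qed.

(** The matrix [V] with columns [v j] is square, so [V^T *m V = 1%:M] also gives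
    [V *m V^T = 1%:M]. *)
Lemma orthonormal_complete (v : 'I_N -> 'cV[R]_N) :
  (forall i j, coordinate (v i) (v j) = (i == j)%:R) ->
  \sum_j v j *m (v j)^T = 1%:M.
Proof.
move=> ov; pose V : 'M[R]_N := \matrix_(i, j) v j i 0.
have /mulmx1C <- : V^T *m V = 1%:M.
  apply/matrixP => i j; rewrite [RHS]mxE -ov mxE /coordinate mxE.
  by apply: eq_bigr => k _; rewrite !mxE.
apply/matrixP => i j; rewrite summxE mxE.
by apply: eq_bigr => k _; rewrite !mxE big_ord1 !mxE.
Qed.

End Bilform.

(** * Spectrum of the tridiagonal Toeplitz matrix *)

Section ToeplitzSpectrum.
Context (R : realType) (L : nat).

Definition lam (k : 'I_L) : R := cos (k.+1%:R * pi / L.+1%:R).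

Lemma angle_itv m : (0 < m <= L)%N -> 0 < (m%:R * pi / L.+1%:R : R) < pi.
Proof.
move=> /andP[m0 mL]; rewrite -mulrA mulr_gt0 ?divr_gt0 ?pi_gt0 ?ltr0n//=.
by rewrite mulrCA gtr_pMr ?pi_gt0// ltr_pdivrMr ?ltr0n// mul1r ltr_nat.
Qed.

Lemma lam_itv (k : 'I_L) : k.+1%:R * pi / L.+1%:R \in `[0 : R, pi].
Proof.
have /andP[a b] := @angle_itv k.+1 (ltn_ord k).
by rewrite in_itv/= !ltW.
Qed.

Lemma lt_lam (k k' : 'I_L) : (lam k < lam k') = (k' < k)%N.
Proof.
rewrite /lam ltr_cos ?lam_itv//.
by rewrite ltr_pM2r ?invr_gt0 ?ltr0n// ltr_pM2r ?pi_gt0// ltr_nat.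
Qed.

Lemma rho_maxE (h : (0 < L)%N) : rho_max R L = lam (Ordinal h).
Proof. by rewrite /rho_max /lam mul1r. Qed.

(** The cosine decreases on [[0, pi]], so the extreme eigenvalues are the first and the last; the
    last is [- rho_max], since its angle is [pi - pi / L.+1]. *)
Lemma lam_norm_le (k : 'I_L) : `|lam k| <= rho_max R L.
Proof.
have L0 : (0 < L)%N by case: (L) k => [[]|].
have i1 : pi / L.+1%:R \in `[0 : R, pi].
  by have := lam_itv (Ordinal L0); rewrite mul1r.
rewrite ler_norml; apply/andP; split; last first.
  by rewrite (rho_maxE L0) leNgt lt_lam.
have -> : - rho_max R L = cos (pi - pi / L.+1%:R).
  by rewrite cosB cospi sinpi mul0r addr0 mulN1r.
have eL : pi - pi / L.+1%:R = L%:R * pi / L.+1%:R :> R.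
  by have n0 : L.+1%:R != 0 :> R; [rewrite pnatr_eq0|rewrite -natr1 in n0 *; field].
rewrite /lam leNgt ltr_cos ?lam_itv//; last first.
  have /andP[a b] : 0 < (L%:R * pi / L.+1%:R : R) < pi.
    by apply: angle_itv; rewrite L0 leqnn.
  by rewrite eL in_itv/= !ltW.
rewrite eL -leNgt ler_pM2r ?invr_gt0 ?ltr0n// ler_pM2r ?pi_gt0// ler_nat.
exact: ltn_ord.
Qed.

(** This is [sin (a + th) + sin (a - th) = 2 * cos th * sin a] row by row. The first and last rows
    lack a neighbour, but the missing values [s 0] and [s L.+1] are zero. *)
Lemma Mmx_sinvec (k : 'I_L) : Mmx R L *m sinvec R k = lam k *: sinvec R k.
Proof.
pose th : R := k.+1%:R * pi / L.+1%:R; pose s m : R := sin (m%:R * th).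
have sE (m : 'I_L) : sinvec R k m 0 = s m.+1.
  by rewrite mxE /s /th natrM !mulrA.
have s0 : s 0%N = 0 by rewrite /s mul0r sin0.
have sL : s L.+1 = 0.
  rewrite /s /th; have -> : L.+1%:R * (k.+1%:R * pi / L.+1%:R) = pi *+ k.+1 :> R.
    by rewrite mulrC divfK ?pnatr_eq0// mulr_natl.
  elim: k.+1 => [|m IH]; first by rewrite sin0.
  by rewrite mulrS sinD sinpi mul0r add0r IH mulr0.
apply/matrixP => r j; rewrite ord1 mxE [RHS]mxE sE.
have E1 : \sum_(c < L) (if r.+1 == c :> nat then 2^-1 * s c.+1 else 0) = 2^-1 * s r.+2.
  rewrite -big_mkcond /=; case: (ltnP r.+1 L) => h.
    by rewrite (big_pred1 (Ordinal h)).
  rewrite (_ : r.+2 = L.+1); last first.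
    by congr S; apply/eqP; rewrite eqn_leq h andbT; exact: ltn_ord.
  rewrite sL mulr0 big1 // => c /eqP e.
  by have := ltn_ord c; rewrite -e ltnNge h.
have E2 : \sum_(c < L) (if c.+1 == r :> nat then 2^-1 * s c.+1 else 0) = 2^-1 * s r.
  rewrite -big_mkcond /=; case: r {E1} => -[|r] hr /=.
    by rewrite s0 mulr0 big_pred0.
  by rewrite (big_pred1 (Ordinal (ltnW hr))).
have -> : \sum_c Mmx R L r c * sinvec R k c 0 =
    \sum_(c < L) ((if r.+1 == c :> nat then 2^-1 * s c.+1 else 0) +
     (if c.+1 == r :> nat then 2^-1 * s c.+1 else 0)).
  apply: eq_bigr => c _; rewrite sE mxE.
  case: (eqVneq r.+1 (c : nat)) => [<-|_] /=.
    by rewrite gtn_eqF ?addr0// ltnS leqnSn.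
  by case: eqP; rewrite ?mul0r ?add0r.
rewrite big_split /= E1 E2 /s /lam -/th.
rewrite (_ : r.+2%:R * th = r.+1%:R * th + th); last by rewrite -natr1 mulrDl mul1r.
rewrite (_ : (r : nat)%:R * th = r.+1%:R * th - th); last by rewrite -natr1 mulrDl mul1r addrK.
by rewrite sinD sinB; field.
Qed.

Lemma Mmx_tr : (Mmx R L)^T = Mmx R L.
Proof. by apply/matrixP => i j; rewrite !mxE orbC. Qed.

Lemma sinvec_norm_gt0 (k : 'I_L) : 0 < \sum_(m < L) sinvec R k m 0 ^+ 2.
Proof.
have L0 : (0 < L)%N by case: (L) k => [[]|].
rewrite (bigD1 (Ordinal L0)) //=; apply: ltr_wpDr; first by apply: sumr_ge0 => m _; exact: sqr_ge0.
by rewrite exprn_gt0// mxE mul1n sin_gt0_pi// angle_itv//= ltn_ord.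
Qed.

Lemma Mmx_Mvec (k : 'I_L) : Mmx R L *m Mvec R k = lam k *: Mvec R k.
Proof. by rewrite /Mvec -scalemxAr Mmx_sinvec !scalerA mulrC. Qed.

(** Eigenvectors of a symmetric matrix for distinct eigenvalues are orthogonal; the diagonal case is
    the normalization. *)
Lemma Mvec_orthonormal (k k' : 'I_L) : coordinate (Mvec R k) (Mvec R k') = (k == k')%:R.
Proof.
have [<-|kk] := eqVneq k k'.
  have p0 := sinvec_norm_gt0 k; rewrite /coordinate /Mvec; set q := Num.sqrt _.
  rewrite -scalemxAr linearZ /= -scalemxAl !mxE mulrA -expr2 exprVn sqr_sqrtr ?ltW//.
  under [X in _ * X]eq_bigr => m _ do rewrite [_^T _ _]mxE -expr2.
  by rewrite mulVf// gt_eqF.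
have lk : lam k != lam k'.
  by rewrite neq_lt !lt_lam -neq_ltn eq_sym.
move: lk; rewrite -subr_eq0 => lk.
apply: (mulfI lk); rewrite mulr0 mulrBl; apply/eqP; rewrite subr_eq0; apply/eqP.
have -> : lam k' * coordinate (Mvec R k) (Mvec R k') = bilform (Mmx R L) (Mvec R k) (Mvec R k').
  by rewrite /bilform -mulmxA Mmx_Mvec -scalemxAr [RHS]mxE.
rewrite bilform_sym ?Mmx_tr// /bilform -mulmxA Mmx_Mvec -scalemxAr [RHS]mxE.
by rewrite -/(coordinate _ _) coordinateC.
Qed.

End ToeplitzSpectrum.

(** * Kronecker product identities *)

Section Kronecker.
Context (R : comPzRingType).

Lemma tensZl m n p q (c : R) (A : 'M[R]_(m, n)) (B : 'M[R]_(p, q)) :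
  (c *: A) *t B = c *: (A *t B).
Proof. by apply/matrixP => i j; rewrite !mxE mulrA. Qed.

Lemma tensZr m n p q (c : R) (A : 'M[R]_(m, n)) (B : 'M[R]_(p, q)) :
  A *t (c *: B) = c *: (A *t B).
Proof. by apply/matrixP => i j; rewrite !mxE mulrCA. Qed.

Lemma tens1mx1 m n : (1%:M : 'M[R]_m) *t (1%:M : 'M[R]_n) = 1%:M.
Proof.
apply/matrixP => i j; rewrite -(mxtens_unindexK i) -(mxtens_unindexK j).
case: (mxtens_unindex i) (mxtens_unindex j) => [a b] [c d].
by rewrite tensmxE !mxE (can_eq (@mxtens_indexK _ _)) -natrM mulnb.
Qed.

(** The pair lists the index of the right factor first, to match the index order [(k, j)] of
    [tildeV]. *)
Lemma tens_sum m n p q (I J : finType) (A : I -> 'M[R]_(m, n)) (B : J -> 'M[R]_(p, q)) :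
  \sum_(k : J * I) A k.2 *t B k.1 = (\sum_i A i) *t (\sum_j B j).
Proof.
apply/matrixP => i j; rewrite mxE !summxE big_distrlr /= exchange_big pair_bigA.
by apply: eq_bigr => k _; rewrite mxE.
Qed.

End Kronecker.

(** * Joint diagonalization of [tildeI], [tildeM], [tildeN], and the gap identity *)

Section TildeSpectrum.
Context (R : realType) (n L : nat) (Sigma : 'M[R]_n).
Context (sigma : 'I_n -> R) (vs : 'I_n -> 'cV[R]_n).
Context (hSigma : sym_posdef Sigma) (hvs : orthonormal_eigenbasis Sigma sigma vs).
Implicit Types (nu : R) (x y b g : 'cV[R]_(n * L)).

Let tv (p : 'I_L * 'I_n) := tildeV vs p.1 p.2.

(** [sigma j] is the value of the positive definite form at the unit vector [vs j]. *)
Lemma sigma_gt0 j : 0 < sigma j.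
Proof.
have [_ pos] := hSigma; have [eig on] := hvs.
have v0 : vs j != 0.
  apply/eqP => v0; have /eqP := on j j.
  by rewrite v0 mulmx0 mxE eqxx eq_sym oner_eq0.
by have := pos _ v0; rewrite /bilform -mulmxA eig -scalemxAr mxE on eqxx mulr1.
Qed.

(** Tensor product of the resolutions of the identity given by [vs] and by [Mvec]. *)
Lemma tildeV_complete : \sum_p tv p *m (tv p)^T = 1%:M.
Proof.
rewrite -tens1mx1 -(orthonormal_complete (proj2 hvs)).
rewrite -(orthonormal_complete (@Mvec_orthonormal R L)) -tens_sum.
by apply: eq_bigr => p _; rewrite -tensmx_mul -trmx_tens.
Qed.

Lemma tildeV_orthonormal p q : coordinate (tv p) (tv q) = (p == q)%:R.
Proof.
rewrite /coordinate /tv /tildeV; have := tensmx_mul (vs p.2)^T (Mvec R p.1)^T (vs q.2) (Mvec R q.1).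
rewrite -trmx_tens => ->; rewrite mxE !ord1 (proj2 hvs) [X in _ * X]Mvec_orthonormal.
by rewrite -natrM mulnb andbC; case: p q => [? ?] [? ?].
Qed.

Lemma tildeI_tildeV p : tildeI L Sigma *m tv p = sigma p.2 *: tv p.
Proof.
apply: etrans (tensmx_mul Sigma 1%:M (vs p.2) (Mvec R p.1)) _.
by rewrite mul1mx (proj1 hvs) tensZl.
Qed.

Lemma tildeM_tildeV p : tildeM L Sigma *m tv p = (sigma p.2 * lam R p.1) *: tv p.
Proof.
apply: etrans (tensmx_mul Sigma (Mmx R L) (vs p.2) (Mvec R p.1)) _.
by rewrite Mmx_Mvec (proj1 hvs) tensZl tensZr scalerA.
Qed.

Lemma tildeN_tildeV nu p :
  tildeN L Sigma nu *m tv p = (sigma p.2 * (2 * lam R p.1 - nu)) *: tv p.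
Proof.
rewrite /tildeN mulmxBl -!scalemxAl tildeI_tildeV tildeM_tildeV !scalerA -scalerBl.
by congr (_ *: _); ring.
Qed.

Lemma tildeI_gt0 x : x != 0 -> 0 < bilform (tildeI L Sigma) x x.
Proof.
by apply: bilform_diag_gt0 tildeV_complete tildeI_tildeV _ => p; exact: sigma_gt0.
Qed.

Lemma tildeN_lt0 nu x : 2 * rho_max R L < nu -> x != 0 ->
  bilform (tildeN L Sigma nu) x x < 0.
Proof.
move=> hnu x0; rewrite -oppr_gt0 -bilformNmx.
apply: (bilform_diag_gt0 tildeV_complete (c := fun p => sigma p.2 * (nu - 2 * lam R p.1))) x0 => p.
  by rewrite mulNmx tildeN_tildeV -scaleNr -mulrN opprB.
rewrite mulr_gt0 ?sigma_gt0 ?subr_gt0//.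
by have := lam_norm_le R p.1; rewrite ler_norml => /andP[]; lra.
Qed.

Lemma tildeN_gt0 nu x : nu < - (2 * rho_max R L) -> x != 0 ->
  0 < bilform (tildeN L Sigma nu) x x.
Proof.
move=> hnu; apply: bilform_diag_gt0 tildeV_complete (tildeN_tildeV nu) _ => p.
rewrite mulr_gt0 ?sigma_gt0 ?subr_gt0//.
by have := lam_norm_le R p.1; rewrite ler_norml => /andP[]; lra.
Qed.

(** A zero eigenvalue would mean [nu = 2 * lam k], which is at most [2 * rho_max] in absolute
    value. *)
Lemma tildeN_unitmx nu : 2 * rho_max R L < `|nu| -> tildeN L Sigma nu \in unitmx.
Proof.
move=> hnu; apply: unitmx_diag tildeV_complete (tildeN_tildeV nu) _ => p.
rewrite mulf_neq0 ?(gt_eqF (sigma_gt0 _))// subr_eq0; apply: contraTneq hnu => <-.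
by rewrite -leNgt normrM ger0_norm// ler_pM2l// lam_norm_le.
Qed.

Lemma tildeI_tr : (tildeI L Sigma)^T = tildeI L Sigma.
Proof. by rewrite /tildeI trmx_tens trmx1 (proj1 hSigma). Qed.

Lemma tildeM_tr : (tildeM L Sigma)^T = tildeM L Sigma.
Proof. by rewrite /tildeM trmx_tens Mmx_tr (proj1 hSigma). Qed.

Lemma tildeN_tr nu : (tildeN L Sigma nu)^T = tildeN L Sigma nu.
Proof. by rewrite /tildeN linearB /= !linearZ /= tildeI_tr tildeM_tr. Qed.

Lemma bilform_tildeN nu x y : bilform (tildeN L Sigma nu) x y =
  2 * bilform (tildeM L Sigma) x y - nu * bilform (tildeI L Sigma) x y.
Proof. by rewrite /bilform /tildeN mulmxBr mulmxBl -!scalemxAr -!scalemxAl !mxE. Qed.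

(* Since [tildeN b] is proportional to [tildeI g], the constraints fix the cross
   term, and the gap in the objective is exactly a quadratic form in [b' - b]. *)
Lemma stationary_gap nu D g b b' :
  tildeN L Sigma nu *m b = D *: (tildeI L Sigma *m g) ->
  bilform (tildeI L Sigma) b' b' = bilform (tildeI L Sigma) b b ->
  bilform (tildeI L Sigma) b' g = bilform (tildeI L Sigma) b g ->
  bilform (tildeN L Sigma nu) (b' - b) (b' - b) =
  2 * (bilform (tildeM L Sigma) b' b' - bilform (tildeM L Sigma) b b).
Proof.
move=> st eqI eqg.
have cross x : bilform (tildeN L Sigma nu) x b = D * bilform (tildeI L Sigma) x g.
  by rewrite -bilformZr; apply: bilform_mulmx; rewrite -scalemxAr.
have -> : bilform (tildeN L Sigma nu) (b' - b) (b' - b) =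
    bilform (tildeN L Sigma nu) b' b' - bilform (tildeN L Sigma nu) b b.
  rewrite bilformBl !bilformBr (bilform_sym b b' (tildeN_tr nu)) !cross eqg; ring.
rewrite !bilform_tildeN eqI; ring.
Qed.

(** Trades the inverse for the linear stationarity equation on which the gap identity rests. *)
Lemma mssa_vecP nu D g b : 2 * rho_max R L < `|nu| ->
  b = mssa_vec Sigma g D nu <->
  tildeN L Sigma nu *m b = D *: (tildeI L Sigma *m g).
Proof.
move=> /tildeN_unitmx uN; rewrite /mssa_vec; split => [->|E].
  by rewrite -scalemxAr -mulmxA mulKVmx.
by rewrite -mulmxA scalemxAr -E mulKmx.
Qed.

(** With equal norms both correlations share one positive denominator, so the correlation constraint
    becomes linear. *)
Lemma target_corr_inj g b b' : g != 0 -> b != 0 ->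
  bilform (tildeI L Sigma) b' b' = bilform (tildeI L Sigma) b b ->
  target_corr Sigma g b' = target_corr Sigma g b ->
  bilform (tildeI L Sigma) b' g = bilform (tildeI L Sigma) b g.
Proof.
move=> g0 b0; rewrite /target_corr => ->; apply: mulIf.
by rewrite invr_eq0 gt_eqF// sqrtr_gt0 mulr_gt0 ?tildeI_gt0.
Qed.

End TildeSpectrum.

(** * Sufficiency: feasible vectors of the stationary form are optimal *)

Section Optimality.
Context (R : realType) (n L : nat) (Sigma : 'M[R]_n).
Context (sigma : 'I_n -> R) (vs : 'I_n -> 'cV[R]_n).
Context (hSigma : sym_posdef Sigma) (hvs : orthonormal_eigenbasis Sigma sigma vs).
Context (d : measure_display) (T : measurableType d) (P : probability T R).
Context (eps : int -> 'I_n -> T -> R) (heps : white_noise P Sigma eps).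
Context (g : 'cV[R]_(n * L)) (t : int) (l : R).
Context (g0 : g != 0) (hl : 0 < l).
Implicit Types (nu D rho_yz : R) (b : 'cV[R]_(n * L)).

(** On the feasible set the [tildeM] form is [l] times the autocorrelation, so the sign of the
    [tildeN] form decides which vector is better. *)
Lemma dual_feasible_gap nu D rho_yz b b' :
  2 * rho_max R L < `|nu| -> b = mssa_vec Sigma g D nu ->
  dual_feasible Sigma g l rho_yz b -> dual_feasible Sigma g l rho_yz b' ->
  bilform (tildeN L Sigma nu) (b' - b) (b' - b) =
  2 * l * (autocorr1 P (predictor eps b') t - autocorr1 P (predictor eps b) t).
Proof.
move=> hnu /(mssa_vecP hSigma hvs _ _ _ hnu) st [cb lb] [cb' lb'].
have b0 : b != 0.
  by apply: contraTneq hl => b0; rewrite -lb b0 /bilform mulmx0 mxE ltxx.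
rewrite (stationary_gap hSigma st) ?lb ?lb'//; last first.
  by apply: (target_corr_inj hSigma hvs) => //; rewrite ?lb ?lb' ?cb ?cb'.
by rewrite !(autocorr1_predictorE _ _ (proj1 hSigma) heps) lb lb'; field; rewrite gt_eqF.
Qed.

(** Here [tildeN] is negative definite: no feasible [b'] beats [b], and strictness for [b' != b]
    gives uniqueness. *)
Lemma dual_solution_stationary nu D rho_yz b :
  2 * rho_max R L < nu -> b = mssa_vec Sigma g D nu ->
  dual_feasible Sigma g l rho_yz b ->
  dual_solution P Sigma eps g t l rho_yz b /\
  forall b', dual_solution P Sigma eps g t l rho_yz b' -> b' = b.
Proof.
move=> hnu bE fb; have hnu' := lt_le_trans hnu (ler_norm nu).
have l2 : 0 < 2 * l by rewrite mulr_gt0.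
have gap b' := dual_feasible_gap hnu' bE fb (b' := b').
split; [split => // b' fb'|move=> b' [fb' /(_ _ fb) opt]].
  rewrite -subr_le0 -(pmulr_rle0 _ l2) -gap//.
  have [->|ne] := eqVneq (b' - b) 0; first by rewrite /bilform mulmx0 mxE.
  exact/ltW/(tildeN_lt0 hSigma hvs).
apply/eqP; rewrite -subr_eq0; apply/negP => /negP ne.
have := tildeN_lt0 hSigma hvs hnu ne.
by rewrite gap// pmulr_rlt0// subr_lt0 ltNge opt.
Qed.

(** Here [tildeN] is positive definite, so the gap has the opposite sign. *)
Lemma dual_min_solution_stationary nu D rho_yz b :
  nu < - (2 * rho_max R L) -> b = mssa_vec Sigma g D nu ->
  dual_feasible Sigma g l rho_yz b ->
  dual_min_solution P Sigma eps g t l rho_yz b.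
Proof.
move=> hnu bE fb.
have hnu' : 2 * rho_max R L < `|nu| by rewrite -normrN (lt_le_trans _ (ler_norm _))// ltrNr.
have l2 : 0 < 2 * l by rewrite mulr_gt0.
split => // b' fb'; rewrite -subr_ge0 -(pmulr_rge0 _ l2).
rewrite -(dual_feasible_gap hnu' bE fb fb').
have [->|ne] := eqVneq (b' - b) 0; first by rewrite /bilform mulmx0 mxE.
exact/ltW/(tildeN_gt0 hSigma hvs).
Qed.

End Optimality.

(** * A feasible stationary vector with [nu > 2 * rho_max], by continuity *)

Section Existence.
Local Open Scope classical_set_scope.
Context (R : realType) (n L : nat) (Sigma : 'M[R]_n) (hL : (1 <= L)%N).
Context (sigma : 'I_n -> R) (vs : 'I_n -> 'cV[R]_n).
Context (hSigma : sym_posdef Sigma) (hvs : orthonormal_eigenbasis Sigma sigma vs).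
Context (w : 'I_L -> 'I_n -> R) (hsupp : complete_spectral_support w).

Let I := ('I_L * 'I_n)%type.
Let k1 : 'I_L := Ordinal hL.
Let tv (p : I) := tildeV vs p.1 p.2.
Let g := \sum_(k < L) \sum_(j < n) w k j *: tildeV vs k j.
Let synth (a : I -> R) := \sum_p a p *: tv p.
Let wt (p : I) := w p.1 p.2.

Lemma coordinate_synth p a : coordinate (tv p) (synth a) = a p.
Proof.
rewrite /coordinate /synth mulmx_sumr summxE (bigD1 p)//= big1 ?addr0 => [|q qp].
  by rewrite -scalemxAr mxE [X in _ * X](tildeV_orthonormal hvs) eqxx mulr1.
rewrite -scalemxAr mxE [X in _ * X](tildeV_orthonormal hvs) eq_sym (negbTE qp).
by rewrite mulr0.
Qed.

Lemma bilform_synth a a' :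
  bilform (tildeI L Sigma) (synth a) (synth a') = \sum_p sigma p.2 * a p * a' p.
Proof.
rewrite (bilform_diag _ _ (tildeV_complete L hvs) (tildeI_tildeV hvs)).
by apply: eq_bigr => p _; rewrite !coordinate_synth.
Qed.

Lemma synth_wt : g = synth wt.
Proof. by rewrite /g pair_bigA. Qed.

(* [shrink tau k] is [(1 - tau) / tau] times [(nu - 2 * lam k)^-1], where
   [nu = 2 * lam k1 + (1 - tau) / tau]: it runs from the identity at [tau = 0]
   ([nu] infinite) to the projection onto the top eigenspace at [tau = 1]. *)
Let gapk (k : 'I_L) := 2 * (lam R k1 - lam R k).
Let shrink tau (k : 'I_L) := if k == k1 then 1 else (1 - tau) / (1 - tau + tau * gapk k).
Let beta tau (p : I) := wt p * shrink tau p.1.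

Lemma gapk_gt0 k : k != k1 -> 0 < gapk k.
Proof.
move=> kk; rewrite mulr_gt0// subr_gt0 lt_lam /= lt0n.
by apply: contra kk => /eqP e; apply/eqP/val_inj.
Qed.

(** A convex combination of [1] and [gapk k], both positive. *)
Lemma shrink_denom_gt0 tau k : 0 <= tau <= 1 -> k != k1 ->
  0 < 1 - tau + tau * gapk k.
Proof.
move=> /andP[t0 t1] /gapk_gt0 c0; have [->|t1'] := eqVneq tau 1.
  by rewrite subrr add0r mul1r.
by rewrite ltr_pwDl ?subr_gt0 ?lt_neqAle ?t1'// mulr_ge0// ltW.
Qed.

Lemma continuous_shrink k tau : 0 <= tau <= 1 -> {for tau, continuous (shrink^~ k)}.
Proof.
move=> htau; rewrite /shrink.
have [_|kk] := eqVneq k k1; first exact: cvg_cst.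
apply: cvgM; first by apply: cvgB; [exact: cvg_cst|exact: cvg_id].
apply: cvgV; first by rewrite gt_eqF// shrink_denom_gt0.
apply: cvgD; first by apply: cvgB; [exact: cvg_cst|exact: cvg_id].
by apply: cvgM; [exact: cvg_id|exact: cvg_cst].
Qed.

(** The weights at [k1] are never shrunk, and complete support makes one of them nonzero. *)
Lemma beta_norm_gt0 tau : 0 < \sum_p sigma p.2 * beta tau p * beta tau p.
Proof.
have ge0 (p : I) : 0 <= sigma p.2 * beta tau p * beta tau p.
  by rewrite -mulrA mulr_ge0 ?(ltW (sigma_gt0 hSigma hvs _))// -expr2 sqr_ge0.
rewrite lt_def sumr_ge0 ?andbT//; apply/eqP => /psumr_eq0P z.
have /eqP[] := hsupp k1; apply: big1 => j _.
have /eqP : sigma j * beta tau (k1, j) * beta tau (k1, j) = 0 by exact: (z _ (k1, j)).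
rewrite -mulrA mulf_eq0 gt_eqF ?(sigma_gt0 hSigma hvs)//= mulf_eq0 orbb.
by rewrite /beta /shrink eqxx mulr1 => /eqP; rewrite /wt /= => ->; rewrite normr0.
Qed.

Lemma beta0_wt : beta 0 =1 wt.
Proof.
move=> p; rewrite /beta /shrink; case: eqP => _; rewrite ?mulr1//.
by rewrite subr0 mul0r addr0 divr1 mulr1.
Qed.

Lemma synth_beta1 : synth (beta 1) = \sum_(j < n) w k1 j *: tildeV vs k1 j.
Proof.
rewrite /synth -(pair_bigA _ (fun k j => beta 1 (k, j) *: tildeV vs k j)) /=.
rewrite (bigD1 k1)//= [X in _ + X]big1 ?addr0 => [|k kk].
  by apply: eq_bigr => j _; rewrite /beta /shrink eqxx mulr1.
apply: big1 => j _.
by rewrite /beta /shrink /= (negbTE kk) subrr mul0r mulr0 scale0r.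
Qed.

Lemma synth_beta0 : synth (beta 0) = g.
Proof. by rewrite synth_wt; apply: eq_bigr => p _; rewrite beta0_wt. Qed.

Lemma spectral_support_neq0 : g != 0.
Proof.
apply/eqP => g0; have := beta_norm_gt0 0.
by rewrite -bilform_synth synth_beta0 g0 /bilform mulmx0 mxE ltxx.
Qed.

(** The factor [shrink tau k] is built to cancel [2 * lam k - nu] up to the constant
    [- ((1 - tau) / tau)], the same for every [k]. *)
Lemma tildeN_synth_beta tau : 0 < tau < 1 ->
  tildeN L Sigma (2 * lam R k1 + (1 - tau) / tau) *m synth (beta tau) =
  - ((1 - tau) / tau) *: (tildeI L Sigma *m g).
Proof.
move=> /andP[t0 t1]; rewrite synth_wt !mulmx_sumr scaler_sumr.
apply: eq_bigr => p _; rewrite -!scalemxAr (tildeN_tildeV hvs) (tildeI_tildeV hvs).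
rewrite !scalerA; congr (_ *: _); rewrite /beta /shrink.
case: eqVneq => [->|kk]; first ring.
have dn : 1 - tau + tau * gapk p.1 != 0.
  by rewrite gt_eqF// shrink_denom_gt0// !ltW.
have tn : tau != 0 by rewrite gt_eqF.
by move: dn; rewrite /gapk => dn; field; rewrite tn.
Qed.

Lemma exists_mssa_feasible (l rho : R) : 0 < l ->
  target_corr Sigma g (\sum_(j < n) w k1 j *: tildeV vs k1 j) < rho ->
  rho < target_corr Sigma g g ->
  exists nu D b, [/\ 2 * rho_max R L < nu, D != 0,
    b = mssa_vec Sigma g D nu & dual_feasible Sigma g l rho b].
Proof.
move=> l0 lo hi; set IS := tildeI L Sigma.
pose A tau := \sum_p sigma p.2 * beta tau p * wt p.
pose B tau := \sum_p sigma p.2 * beta tau p * beta tau p.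
pose G := bilform IS g g.
(* [F tau] has the sign of the correlation minus [rho]; clearing the positive denominator leaves a
   zero to be found. *)
pose F tau := A tau - rho * Num.sqrt (B tau * G).
have G0 : 0 < G by apply: (tildeI_gt0 hSigma hvs); exact: spectral_support_neq0.
have sBG tau : 0 < Num.sqrt (B tau * G).
  by rewrite sqrtr_gt0 mulr_gt0// beta_norm_gt0.
have corrE tau : target_corr Sigma g (synth (beta tau)) = A tau / Num.sqrt (B tau * G).
  by rewrite /target_corr bilform_synth [in X in X / _]synth_wt bilform_synth.
have F1 : F 1 < 0.
  by rewrite /F subr_lt0 -ltr_pdivrMr// -corrE synth_beta1.
have F0 : 0 < F 0.
  by rewrite /F subr_gt0 -ltr_pdivlMr// -corrE synth_beta0.
have cbeta p tau : 0 <= tau <= 1 -> {for tau, continuous (beta^~ p)}.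
  by move=> htau; apply: cvgM; [exact: cvg_cst|exact: continuous_shrink].
have cF : {within `[0, 1], continuous F}.
  apply: continuous_in_subspaceT => tau; rewrite inE /= in_itv /= => htau.
  apply: cvgB.
    apply: cvg_big => [|p _]; [exact: add_continuous|]; apply: cvgM; last exact: cvg_cst.
    by apply: cvgM; [exact: cvg_cst|exact: cbeta].
  apply: cvgM; first exact: cvg_cst.
  apply: continuous_comp; last exact: sqrt_continuous.
  apply: cvgM; last exact: cvg_cst.
  apply: cvg_big => [|p _]; [exact: add_continuous|]; apply: cvgM; last exact: cbeta.
  by apply: cvgM; [exact: cvg_cst|exact: cbeta].
have [|tau htau Ft] := IVT ler01 cF (v := 0).
  by rewrite ge_min le_max (ltW F1) (ltW F0) orbT.
(* The endpoints must be excluded: [tau = 0] stands for an infinite [nu], and [tau = 1] for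
   [nu = 2 * rho_max], where [tildeN] is singular. *)
have tau01 : 0 < tau < 1.
  move: htau; rewrite in_itv/= !lt_neqAle => /andP[-> ->]; rewrite !andbT.
  apply/andP; split; apply/eqP => e.
    by move: Ft F0; rewrite -e => ->; rewrite ltxx.
  by move: Ft F1; rewrite e => ->; rewrite ltxx.
have /andP[t0 t1] := tau01.
(* Rescaling by [E] meets the norm constraint; a positive factor leaves the correlation
   unchanged. *)
pose E := Num.sqrt (l / B tau).
have E0 : 0 < E by rewrite sqrtr_gt0 divr_gt0// beta_norm_gt0.
have E2 : E ^+ 2 = l / B tau by rewrite sqr_sqrtr// divr_ge0 ?ltW// beta_norm_gt0.
have r0 : 0 < (1 - tau) / tau by rewrite divr_gt0// subr_gt0.
exists (2 * lam R k1 + (1 - tau) / tau), (E * - ((1 - tau) / tau)), (E *: synth (beta tau)).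
have hnu : 2 * rho_max R L < 2 * lam R k1 + (1 - tau) / tau.
  by rewrite (rho_maxE R hL) ltrDl.
split => //.
- by rewrite mulf_neq0 ?oppr_eq0 ?gt_eqF.
- apply/(mssa_vecP hSigma hvs); first exact: lt_le_trans hnu (ler_norm _).
  by rewrite -scalemxAr tildeN_synth_beta// scalerA.
have BE : bilform IS (synth (beta tau)) (synth (beta tau)) = B tau by exact: bilform_synth.
split; last first.
  by rewrite bilformZl bilformZr BE mulrA -expr2 E2 divfK// gt_eqF// beta_norm_gt0.
have AE : bilform IS (synth (beta tau)) g = A tau.
  by rewrite [in LHS]synth_wt; exact: bilform_synth.
rewrite /target_corr !bilformZl bilformZr BE AE -/G mulrA -expr2 -(mulrA (E ^+ 2)).
rewrite sqrtrM ?sqr_ge0// sqrtr_sqr gtr0_norm//.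
move/eqP: Ft; rewrite subr_eq0 => /eqP ->.
by rewrite mulrCA mulfK// gt_eqF// mulr_gt0.
Qed.

End Existence.

(** * Parametric form of the dual solution and its duality with M-SSA *)

Theorem theorem2 (R : realType) (L n : nat) (hL : (1 <= L)%N) (hn : (1 <= n)%N)
  (hLn : (2 < L * n)%N)
  (Sigma : 'M[R]_n) (hSigma : sym_posdef Sigma)
  (sigma : 'I_n -> R) (vs : 'I_n -> 'cV[R]_n)
  (hvs : orthonormal_eigenbasis Sigma sigma vs)
  (d : measure_display) (T : measurableType d) (P : probability T R)
  (eps : int -> 'I_n -> T -> R) (heps : white_noise P Sigma eps)
  (Gam : int -> 'M[R]_n) (hGam : square_summable Gam) (delta : int)
  (hgamma : gamma_mx L Gam delta != 0)
  (i : 'I_n) (w : 'I_L -> 'I_n -> R)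
  (hw : gamma_row L Gam delta i = \sum_(k < L) \sum_(j < n) w k j *: tildeV vs k j)
  (hsupp : complete_spectral_support w)
  (t : int) (l : R) (hl : 0 < l) (rho_yz : R)
  (hrho_low :
     let k1 := Ordinal hL in
     target_corr Sigma (gamma_row L Gam delta i)
       (\sum_(j < n) w k1 j *: tildeV vs k1 j) < rho_yz)
  (hrho_high :
     `|rho_yz| < target_corr Sigma (gamma_row L Gam delta i) (gamma_row L Gam delta i)) :
  let g := gamma_row L Gam delta i in
  let S : R -> Prop := fun nu => 2 * rho_max R L < `|nu| in
  [/\ (exists b, dual_solution P Sigma eps g t l rho_yz b) /\
      (forall b, dual_solution P Sigma eps g t l rho_yz b ->
         exists nu : R, mssa_form Sigma g nu b),
      forall (rho nu0 D0 : R) (b0 : 'cV[R]_(n * L)),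
        mssa_solution Sigma g l rho b0 ->
        b0 = mssa_vec Sigma g D0 nu0 ->
        2 * rho_max R L < nu0 ->
        rho_yz = target_corr Sigma g b0 ->
        search_confined_to Sigma g S (dual_solution P Sigma eps g t l rho_yz) ->
        dual_solution P Sigma eps g t l rho_yz b0
    & forall (rho nu0 D0 : R) (b0 : 'cV[R]_(n * L)),
        mssa_solution Sigma g l rho b0 ->
        b0 = mssa_vec Sigma g D0 nu0 ->
        nu0 < - (2 * rho_max R L) ->
        rho_yz = target_corr Sigma g b0 ->
        search_confined_to Sigma g S (dual_min_solution P Sigma eps g t l rho_yz) ->
        dual_min_solution P Sigma eps g t l rho_yz b0].
Proof.
move=> g S.
have g0 : g != 0 by rewrite /g hw; exact: (spectral_support_neq0 hL hSigma hvs hsupp).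
split.
- have [nu [D [b [hnu D0 bE fb]]]] : exists nu D b,
      [/\ 2 * rho_max R L < nu, D != 0, b = mssa_vec Sigma g D nu
        & dual_feasible Sigma g l rho_yz b].
    move: hrho_low (le_lt_trans (ler_norm _) hrho_high); rewrite /g hw => lo hi.
    exact: (exists_mssa_feasible hSigma hvs hsupp hl lo hi).
  (* Uniqueness transfers the parametric form of this one maximizer to every solution. *)
  have [sol uniq] := dual_solution_stationary hSigma hvs heps t g0 hl hnu bE fb.
  split; first by exists b.
  move=> b' /uniq ->; exists nu; split; last by exists D.
  exact/(tildeN_unitmx hSigma hvs)/(lt_le_trans hnu)/ler_norm.
(* [b0] is dual feasible: its norm constraint is that of the M-SSA problem, and [rho_yz] is its own
   target correlation. *)
- move=> rho nu0 D0 b0 [[_ lb] _] bE hnu cb _.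
  by have [] := dual_solution_stationary hSigma hvs heps t g0 hl hnu bE (conj (esym cb) lb).
- move=> rho nu0 D0 b0 [[_ lb] _] bE hnu cb _.
  exact: (dual_min_solution_stationary hSigma hvs heps t g0 hl hnu bE (conj (esym cb) lb)).
Qed.
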